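(* Let $\epsilon > 0$ and $\Delta > 0$, let $T\ge1$ be an integer, let $W_1,W_2,\ldots$ be i.i.d. standard Gaussian random variables and let $\hat \mu_t = \frac1t\sum_{s=1}^t W_s$ for $t\ge 1$. Then the following hold: (a) $$\mathbb{E}\left[\min\left\{t\ge 1 : \sup_{s \geq t} |\hat \mu_s| < \epsilon\right\}\right] \leq 1 + \frac{9}{\epsilon^2}.$$ (b) If $T\Delta^2\geq 2$ then $$\sum_{n=1}^T \mathbb{P}\left(\hat \mu_n + \sqrt{\frac{2}{n} \log\left(\frac{T}{n}\right)} \geq \Delta\right) \leq \frac{2 \log\left(\frac{T\Delta^2}{2}\right)}{\Delta^2} + \frac{2\sqrt{\pi\log\left(\frac{T\Delta^2}{2}\right)}}{\Delta^2} + \frac{2}{\Delta^2} + 1 .$$ (c) If $T\epsilon^2 \geq e^2$ then $$\mathbb{P}\left(\exists s \in\{1,\dots,T\} : \hat \mu_s + \sqrt{\frac{2}{s} \log\left(\frac{T}{s}\right)} + \epsilon \leq 0\right) \leq \frac{30e \sqrt{\log(\epsilon^2 T)}}{\epsilon^2 T} + \frac{16e}{\epsilon^2 T} .$$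
   Context: $\log$ denotes the natural logarithm. *)

(* Defs.v *)
From HB Require Import structures.
From mathcomp Require Import all_boot all_order all_algebra.
From mathcomp Require Import finmap.
From mathcomp Require Import all_classical all_reals all_analysis.

Set Implicit Arguments.
Unset Strict Implicit.
Unset Printing Implicit Defensive.

Import Order.TTheory GRing.Theory Num.Theory.
Import numFieldNormedType.Exports.

Local Open Scope classical_set_scope.
Local Open Scope ring_scope.

Definition mutually_independent (d : measure_display) (Omega : measurableType d)
    (R : realType) (P : probability Omega R) (I : choiceType) (D : set I)
    (X : I -> {RV P >-> R}) : Prop :=
  forall (J : {fset I}) (B : I -> set R),
    [set` J] `<=` D ->
    (forall i, i \in J -> measurable (B i)) ->
    P (\bigcap_(i in [set` J]) (X i @^-1` B i)) =
      (\prod_(i <- J) P (X i @^-1` B i))%E.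

(* Laws are compared on Borel sets only: the value of a measure outside the
   sigma-algebra is unspecified. *)
Definition standard_gaussian (d : measure_display) (Omega : measurableType d)
    (R : realType) (P : probability Omega R) (X : {RV P >-> R}) : Prop :=
  forall B : set R, measurable B -> distribution P X B = normal_prob 0 1 B.

(* The sequence is W 1, W 2, ...; nothing is assumed about W 0, which is not
   used. *)
Definition iid_standard_gaussian (d : measure_display)
    (Omega : measurableType d) (R : realType) (P : probability Omega R)
    (W : nat -> {RV P >-> R}) : Prop :=
  mutually_independent [set s | (1 <= s)%N] W /\
  forall s, (1 <= s)%N -> standard_gaussian (W s).

Definition emp_mean (d : measure_display) (Omega : measurableType d)
    (R : realType) (P : probability Omega R) (W : nat -> {RV P >-> R})
    (t : nat) (w : Omega) : R :=
  t%:R^-1 * \sum_(1 <= s < t.+1) W s w.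

(* min {t >= 1 : sup_(s >= t) |emp_mean s| < eps}, which is +oo when there is no
   such t (ereal_inf set0 = +oo); otherwise the infimum of a nonempty set of
   naturals is its minimum.  The supremum is taken in \bar R, so that an
   unbounded sequence has supremum +oo. *)
Definition settling_time (d : measure_display) (Omega : measurableType d)
    (R : realType) (P : probability Omega R) (W : nat -> {RV P >-> R})
    (eps : R) (w : Omega) : \bar R :=
  ereal_inf [set (t%:R : R)%:E | t in [set t | (1 <= t)%N /\
    (ereal_sup [set `|emp_mean W s w|%:E | s in [set s | (t <= s)%N]]
       < eps%:E)%E]].

(* Main.v *)
Require Import Defs.
From HB Require Import structures.
From mathcomp Require Import all_boot all_order all_algebra.
From mathcomp Require Import finmap.
From mathcomp Require Import all_classical all_reals all_analysis.
From mathcomp Require Import measurable_realfun.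
From mathcomp Require Import ring lra.

(** Write S_n = W_1 + ... + W_n.  All three estimates come from one maximal
    inequality.  For a real l the process exp (l S_n - n l^2/2) is a positive
    martingale of mean 1, so by Ville's inequality (ville_gaussian)
      P (there is n with l S_n - n l^2/2 >= c) <= exp (- c),
    that is, S_n ever crosses a straight line a + b n / 2 with probability at
    most exp (- a b).  Each event below is compared with such line crossings.
    The martingale property needs the next step to be independent of the whole
    past; it is extended by a pi-lambda argument from the product rule on
    cylinders (past_indep), and Ville's inequality then follows by stopping at
    the first passage.

    (a) If |mean_s| >= e for some s >= t, then S_s or - S_s is above s e, hence
    above e (s + t) / 2, which has probability at most 2 exp (- t e^2/2).  The
    settling time is at most 1 plus the number of t for which this happens, and
    a geometric series gives 1 + 4 / e^2.  Requiring the strict bound eps on a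
    supremum forces e < eps; e = 2 eps / 3 turns 4 / e^2 into 9 / eps^2.

    (b) Put l = log (T Delta^2 / 2) and u = 2 l / Delta^2.  If l <= 1, the
    number T of terms is already small enough.  Otherwise the terms with n <= u,
    and the next one, are bounded by 1; for n > u the logarithm in the n-th
    term is at most l, and the term is at most exp (- x^2/2) with
    x = Delta sqrt n - sqrt (2 l) >= 0.  The latter sum is compared with
    an integral over n, and the substitution by x produces
    (2 / Delta^2) (1 + sqrt (2 l) sqrt (pi / 2)) (shifted_gaussian_sum).

    (c) Put y = eps^2 T, L = log y and r = 1 + 1 / sqrt L, and cut the times
    into blocks r^(2k) <= s <= r^(2k+2).  On a block ending at v <= T / exp 1 the
    boundary sqrt (2 s log (T/s)) + s eps is above x sqrt s + s eps with
    x = sqrt (2 log (T/v)), hence above the chord of that concave function.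
    Crossing the chord has probability at most a constant times
    y^-1 w / (1 + w)^2, where w = eps sqrt v (block_exponent_bound); the ratio r
    is so close to 1 that the chord costs only a constant factor.  As w runs
    through a geometric progression of ratio r, the sum over all blocks is at
    most a constant times r / ((r - 1) y) = (sqrt L + 1) / y.  The remaining
    times exceed T / (r^2 exp 1), and there the line s eps alone is crossed with
    probability O(1 / y). *)

Set Implicit Arguments.
Unset Strict Implicit.
Unset Printing Implicit Defensive.

Import Order.TTheory GRing.Theory Num.Theory.
Import numFieldNormedType.Exports.

Local Open Scope classical_set_scope.
Local Open Scope ring_scope.

(** * The exponential moment of the normal law *)

Section change_of_measure.
Context d (T : measurableType d) (R : realType).
Context (mu nu : {measure set T -> \bar R}) (h : T -> R).
Hypothesis mh : measurable_fun setT h.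
Hypothesis h0 : forall x, 0 <= h x.
Hypothesis nuE : forall A, measurable A -> nu A = (\int[mu]_(x in A) (h x)%:E)%E.
Local Open Scope ereal_scope.

Import HBNNSimple.

Let ge0_integral_density_nnsfun (f : {nnsfun T >-> R}) :
  \int[nu]_x (f x)%:E = \int[mu]_x ((f x)%:E * (h x)%:E).
Proof.
transitivity (\sum_(k \in range f) \int[nu]_x (k * \1_(f @^-1` [set k]) x)%:E).
  under eq_integral do rewrite fimfunE -fsumEFin//.
  rewrite ge0_integral_fsum//.
  - by move=> r; exact/measurable_EFinP/measurableT_comp.
  - by move=> r x _; rewrite EFinM nnfun_muleindic_ge0.
transitivity (\sum_(k \in range f)
    \int[mu]_x ((k * \1_(f @^-1` [set k]) x)%:E * (h x)%:E)); last first.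
  rewrite -ge0_integral_fsum//.
  - apply: eq_integral => x _.
    rewrite -ge0_mule_fsuml; last by move=> r; rewrite EFinM nnfun_muleindic_ge0.
    by rewrite fsumEFin// -fimfunE.
  - by move=> r; apply: emeasurable_funM; apply/measurable_EFinP => //;
      exact/measurableT_comp.
  - move=> r x _; apply: mule_ge0; last by rewrite lee_fin.
    by rewrite EFinM nnfun_muleindic_ge0.
apply: eq_fsbigr => r; rewrite inE => -[z _ fzr].
rewrite integralZl_indic_nnsfun// integral_indic//= setIT nuE//.
have r0 : (0 <= r)%R by rewrite -fzr.
under [RHS]eq_integral do rewrite EFinM -muleA.
rewrite ge0_integralZl//; last 2 first.
- by apply: emeasurable_funM; apply/measurable_EFinP => //; exact/measurableT_comp.
- by move=> x _; apply: mule_ge0; rewrite lee_fin.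
congr (_ * _); rewrite [LHS]integral_mkcond; apply: eq_integral => x _.
by rewrite patchE/= indicE; case: ifPn; rewrite (mul1e, mul0e).
Qed.

(** Integration against a measure with a density: both sides are monotone
    limits along simple functions, for which the identity is additivity. *)
Lemma ge0_integral_density (f : T -> \bar R) :
  measurable_fun setT f -> (forall x, 0 <= f x) ->
  \int[nu]_x f x = \int[mu]_x (f x * (h x)%:E).
Proof.
move=> mf f0; pose f_ := nnsfun_approx measurableT mf.
have nd x : {homo (fun n => (f_ n x)%:E) : m n / (m <= n)%N >-> m <= n}.
  by move=> m n mn; rewrite lee_fin; exact/lefP/nd_nnsfun_approx.
transitivity (limn (fun n => \int[nu]_x (f_ n x)%:E)).
  rewrite -monotone_convergence//.
  - apply: eq_integral => x _; apply/esym/cvg_lim => //.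
    by apply: cvg_nnsfun_approx.
  - by move=> n; exact/measurable_EFinP.
  - by move=> n x _; rewrite lee_fin.
transitivity (limn (fun n => \int[mu]_x ((f_ n x)%:E * (h x)%:E))).
  by congr (limn _); apply/funext => n; exact: ge0_integral_density_nnsfun.
rewrite -monotone_convergence//.
- apply: eq_integral => x _; apply/cvg_lim => //.
  by apply: cvgeZr => //; apply: cvg_nnsfun_approx.
- by move=> n; apply: emeasurable_funM; exact/measurable_EFinP.
- by move=> n x _; apply: mule_ge0; rewrite lee_fin.
- by move=> x _ m n mn; apply: lee_wpmul2r; [rewrite lee_fin|exact: nd].
Qed.

End change_of_measure.

Section gaussian.
Context (R : realType).
Local Open Scope ereal_scope.

(** The factor e^(l x) turns the density of N(0,1) into e^(l^2/2) times the
    density of N(l,1), by completing the square. *)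
Lemma normal_mgf (l : R) :
  \int[normal_prob 0 1]_x (expR (l * x))%:E = (expR (l ^+ 2 / 2))%:E.
Proof.
rewrite (@ge0_integral_density _ _ _ lebesgue_measure _ (normal_pdf 0 1))//.
- transitivity (\int[lebesgue_measure]_x
      ((expR (l ^+ 2 / 2))%:E * (normal_pdf l 1 x)%:E)).
    apply: eq_integral => x _; rewrite -!EFinM !normal_pdfE ?oner_eq0//.
    congr (_%:E); rewrite /normal_fun mulrCA [RHS]mulrCA.
    by congr (_ * _)%R; rewrite -!expRD; congr expR; field.
  rewrite ge0_integralZl//.
  + by rewrite integral_normal_pdf mule1.
  + by apply/measurable_EFinP; exact: measurable_normal_pdf.
  + by move=> x _; rewrite lee_fin normal_pdf_ge0.
- exact: measurable_normal_pdf.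
- exact: normal_pdf_ge0.
- by apply/measurable_EFinP; apply: measurableT_comp.
Qed.

End gaussian.

(** * Expectations of independent products *)

Section independent_expectation.
Context d (Omega : measurableType d) (R : realType) (P : probability Omega R).
Context (X Y : {RV P >-> R}).
Hypothesis indepXY : forall A B, measurable A -> measurable B ->
  P (X @^-1` A `&` Y @^-1` B) = (P (X @^-1` A) * P (Y @^-1` B))%E.
Local Open Scope ereal_scope.

(** The product rule says that the joint law of X and Y is the product of their
    laws, so that Tonelli's theorem splits the expectation. *)
Lemma ge0_expectationM_indep (f g : R -> \bar R) :
  measurable_fun setT f -> measurable_fun setT g ->
  (forall x, 0 <= f x) -> (forall x, 0 <= g x) ->
  \int[P]_w (f (X w) * g (Y w)) = \int[P]_w f (X w) * \int[P]_w g (Y w).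
Proof.
move=> mf mg f0 g0.
have mXY : measurable_fun setT (fun w => (X w, Y w)).
  exact: measurable_fun_pair.
pose fg (z : R * R) := f z.1 * g z.2.
have mfg : measurable_fun setT fg.
  by apply: emeasurable_funM; apply: measurableT_comp.
have fg0 z : 0 <= fg z by exact: mule_ge0.
transitivity (\int[pushforward P (fun w => (X w, Y w))]_z fg z).
  by rewrite ge0_integral_pushforward.
transitivity (\int[distribution P X \x distribution P Y]_z fg z).
  apply: eq_measure_integral => A mA _.
  apply/esym.
  by apply: product_measure_unique => // B C mB mC; exact: indepXY.
rewrite fubini_tonelli1//.
transitivity (\int[distribution P X]_x (f x * \int[distribution P Y]_y g y)).
  apply: eq_integral => x _; by rewrite /fubini_F /fg/= ge0_integralZl.
rewrite ge0_integralZr//; last exact: integral_ge0.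
by rewrite !ge0_integral_distribution.
Qed.

End independent_expectation.

(** * Independence of the next step from the past *)

Section past.
Context d (Omega : measurableType d) (R : realType) (P : probability Omega R)
  (W : nat -> {RV P >-> R}).

Definition cylinders (n : nat) : set (set Omega) :=
  [set A | exists2 B : nat -> set R, (forall i, measurable (B i)) &
     A = \bigcap_(i in [set i | (1 <= i <= n)%N]) W i @^-1` B i].

Lemma measurable_cylinders n : cylinders n `<=` measurable.
Proof.
move=> _ [B mB ->]; apply: bigcap_measurableType => i _.
exact: measurable_funPTI.
Qed.

Lemma setI_closed_cylinders n : setI_closed (cylinders n).
Proof.
move=> _ _ [B mB ->] [C mC ->]; exists (fun i => B i `&` C i).
  by move=> i; exact: measurableI.
by rewrite -bigcapI.
Qed.

Lemma cylindersT n : cylinders n setT.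
Proof.
by exists (fun=> setT) => //; apply/seteqP; split.
Qed.

Lemma past_measurable n A : <<s cylinders n >> A -> measurable A.
Proof.
by apply: smallest_sub; [exact: sigma_algebra_measurable|
                         exact: measurable_cylinders].
Qed.

Lemma measurable_fun_past n (f : Omega -> R) :
  measurable_fun setT (f : g_sigma_algebraType (cylinders n) -> R) ->
  measurable_fun setT f.
Proof. by move=> mf _ B mB; apply: (@past_measurable n); exact: mf. Qed.

Lemma measurable_coordinate_past n i : (1 <= i <= n)%N ->
  measurable_fun setT (W i : g_sigma_algebraType (cylinders n) -> R).
Proof.
move=> i1n _ B mB; rewrite setTI; apply: sub_sigma_algebra.
exists (fun j => if j == i then B else setT); first by move=> j; case: ifP.
apply/seteqP; split=> w /= Bw.
  by move=> j _; case: eqVneq => [->//|_]; rewrite preimage_setT.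
by have := Bw i i1n; rewrite eqxx.
Qed.

Hypothesis indepW : mutually_independent [set s | (1 <= s)%N] W.
Local Open Scope ereal_scope.

Let J n := [fset i in iota 1 n]%fset.

Let JE n : [set` J n] = [set i | (1 <= i <= n)%N].
Proof. by apply/seteqP; split=> i /=; rewrite !inE mem_iota add1n ltnS. Qed.

Let cylinder_indep n A C : cylinders n A -> measurable C ->
  P (A `&` W n.+1 @^-1` C) = P A * P (W n.+1 @^-1` C).
Proof.
move=> [B mB ->] mC.
pose B' i := if i == n.+1 then C else B i.
have nJ : (n.+1 \notin J n)%fset by rewrite !inE mem_iota add1n ltnn andbF.
have BE : B' n.+1 = C by rewrite /B' eqxx.
have eqB i : i \in J n -> W i @^-1` B' i = W i @^-1` B i.
  move=> iJ; rewrite /B'; case: eqVneq => // in1.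
  by move: nJ; rewrite -in1 iJ.
have /= := @indepW (n.+1 |` J n)%fset B'.
rewrite bigcap_fset !big_fsetU1//= (eq_big_seq _ eqB) -bigcap_fset JE.
rewrite (_ : \prod_(i <- J n) _ = \prod_(i <- J n) P (W i @^-1` B i)); last first.
  by apply: eq_big_seq => i /eqB ->.
rewrite BE setIC muleC => ->.
- congr (_ * _).
  by have := @indepW (J n) B; rewrite JE => <- // i /andP[].
- move=> i /=; rewrite !inE => /orP[/eqP->//|].
  by rewrite mem_iota => /andP[].
- by move=> i _; rewrite /B'; case: ifP.
Qed.

(** The product rule is given on cylinders, which are stable under
    intersection; both sides are finite measures in the past event. *)
Lemma past_indep n A C : <<s cylinders n >> A -> measurable C ->
  P (A `&` W n.+1 @^-1` C) = P A * P (W n.+1 @^-1` C).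
Proof.
move=> pastA mC; set E := W n.+1 @^-1` C.
have mE : measurable E by exact: measurable_funPTI.
pose PE := NngNum (fine_ge0 (measure_ge0 P E)).
have PEE : PE%:num%:E = P E by rewrite /= fineK// fin_num_measure.
have := @g_sigma_algebra_measure_unique _ R Omega (cylinders n)
  (@measurable_cylinders n) (fun=> setT) (fun=> cylindersT n) _
  (mrestr P mE) (mscale PE P) (@setI_closed_cylinders n).
rewrite bigcup_const// => /(_ erefl) -/(_ _ _ A pastA).
have scaleE B : mscale PE P B = P B * P E by rewrite -PEE muleC.
move=> uniq; rewrite -scaleE; apply: uniq => [B cB|_].
  by rewrite [RHS]scaleE; exact: cylinder_indep.
suff : P (setT `&` E) < +oo by [].
by rewrite setTI -ge0_fin_numE// fin_num_measure.
Qed.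

End past.

(** * Ville's inequality for the Gaussian random walk *)

Section gaussian_walk.
Context d (Omega : measurableType d) (R : realType) (P : probability Omega R)
  (W : nat -> {RV P >-> R}).

Definition walk (n : nat) (w : Omega) : R := \sum_(1 <= i < n.+1) W i w.

Lemma walk0 w : walk 0 w = 0.
Proof. by rewrite /walk big_geq. Qed.

Lemma walkS n w : walk n.+1 w = walk n w + W n.+1 w.
Proof. by rewrite /walk big_nat_recr. Qed.

Lemma measurable_walk_past k n : (k <= n)%N ->
  measurable_fun setT (walk k : g_sigma_algebraType (cylinders W n) -> R).
Proof.
elim: k => [_|k IH kn].
  by rewrite (_ : walk 0 = cst 0)//; apply/funext => w; rewrite walk0.
rewrite (_ : walk k.+1 = walk k \+ W k.+1); last first.
  by apply/funext => w; rewrite walkS.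
by apply: measurable_funD; [apply: IH; exact: ltnW|exact: measurable_coordinate_past].
Qed.

Lemma measurable_walk n : measurable_fun setT (walk n).
Proof. exact: measurable_fun_past (measurable_walk_past (leqnn n)). Qed.

Context (l : R).

Definition log_martingale (n : nat) (w : Omega) : R :=
  l * walk n w - n%:R * (l ^+ 2 / 2).

Lemma measurable_log_martingale_past k n : (k <= n)%N ->
  measurable_fun setT
    (log_martingale k : g_sigma_algebraType (cylinders W n) -> R).
Proof.
move=> kn; apply: measurable_funB => //.
by apply: measurable_funM => //; exact: measurable_walk_past.
Qed.

Lemma measurable_log_martingale n : measurable_fun setT (log_martingale n).
Proof. exact: measurable_fun_past (measurable_log_martingale_past (leqnn n)). Qed.

Hypothesis hW : iid_standard_gaussian W.
Local Open Scope ereal_scope.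

Lemma expectation_expR_gaussian n : (1 <= n)%N ->
  \int[P]_w (expR (l * W n w))%:E = (expR (l ^+ 2 / 2))%:E.
Proof.
case: hW => _ gW n0; rewrite -normal_mgf.
have mf : measurable_fun setT (fun x : R => (expR (l * x))%:E).
  by apply/measurable_EFinP; apply: measurableT_comp.
(* The normal law lives on the Borel sets presented as the sigma-algebra
   generated by intervals, so the law of W n is taken on that presentation. *)
have mW : measurable_fun setT (W n : Omega -> measurableTypeR R).
  by move=> _ B mB; exact: measurable_funPT.
have -> : \int[P]_w (expR (l * W n w))%:E =
    \int[pushforward P (W n : Omega -> measurableTypeR R)]_x (expR (l * x))%:E.
  by rewrite ge0_integral_pushforward// => x _; rewrite lee_fin expR_ge0.
by apply: eq_measure_integral => B mB _; exact: gW.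
Qed.

(** The martingale property: the next factor is independent of the past and
    has expectation 1. *)
Lemma integral_martingaleS n A : <<s cylinders W n >> A ->
  \int[P]_(w in A) (expR (log_martingale n.+1 w))%:E =
  \int[P]_(w in A) (expR (log_martingale n w))%:E.
Proof.
case: (hW) => indepW _ pastA.
have mA : measurable A by exact: past_measurable pastA.
pose X w : R := (expR (log_martingale n w) * \1_A w)%R.
have mXpast :
    measurable_fun setT (X : g_sigma_algebraType (cylinders W n) -> R).
  apply: measurable_funM.
    by apply: measurableT_comp => //; exact: measurable_log_martingale_past.
  exact: measurable_indic.
have mX : measurable_fun setT X := measurable_fun_past mXpast.
pose X' : {RV P >-> R} := HB.pack X (isMeasurableFun.Build _ _ _ _ X mX).
have indepX B C : measurable B -> measurable C ->
    P (X' @^-1` B `&` W n.+1 @^-1` C) = P (X' @^-1` B) * P (W n.+1 @^-1` C).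
  move=> mB mC; apply: past_indep => //.
  by have := mXpast measurableT _ mB; rewrite setTI.
rewrite [LHS]integral_mkcond [RHS]integral_mkcond.
(* X is nonnegative, but f has to be nonnegative on the whole line. *)
pose f : R -> \bar R := fun x => `|x|%:E.
pose g : R -> \bar R := fun x => (expR (l * x - l ^+ 2 / 2))%:E.
have X0 w : (0 <= X w)%R by rewrite mulr_ge0 ?expR_ge0// indicE.
have mg : measurable_fun setT g.
  apply/measurable_EFinP; apply: measurableT_comp => //.
  by apply: measurable_funB => //; exact: measurable_funM.
have mf : measurable_fun setT f.
  by apply/measurable_EFinP; exact: normr_measurable.
have g1 : \int[P]_w g (W n.+1 w) = 1.
  under eq_integral do rewrite /g addrC expRD EFinM.
  rewrite ge0_integralZl//.
    by rewrite expectation_expR_gaussian// -EFinM -expRD addNr expR0.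
  by apply/measurable_EFinP; apply: measurableT_comp => //; exact: measurable_funM.
transitivity (\int[P]_w (f (X' w) * g (W n.+1 w))).
  apply: eq_integral => w _.
  rewrite /f /g /= ger0_norm// -EFinM patchE /X indicE.
  case: (boolP (w \in A)) => _; last by rewrite mulr0 mul0r.
  rewrite mulr1 -expRD; congr (expR _)%:E.
  by rewrite /log_martingale walkS -natr1; ring.
rewrite ge0_expectationM_indep//; last first.
- by move=> x; rewrite lee_fin expR_ge0.
- by move=> x; rewrite lee_fin.
rewrite g1 mule1; apply: eq_integral => w _.
rewrite /f /= ger0_norm// patchE /X indicE.
by case: (boolP (w \in A)) => _; rewrite (mulr1, mulr0).
Qed.

Lemma expectation_martingale n :
  \int[P]_w (expR (log_martingale n w))%:E = 1.
Proof.
elim: n => [|n IH]; last first.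
  rewrite integral_martingaleS//.
  by apply: sub_sigma_algebra; exact: cylindersT.
under eq_integral do rewrite /log_martingale walk0 mulr0 mul0r subr0 expR0.
by rewrite integral_cst//= mul1e probability_setT.
Qed.

(** Ville's inequality for the exponential martingale e^(l S_n - n l^2/2).  On
    the event that the level e^c is first reached at time k, optional stopping
    gives P(event) e^c <= E[M_k; event] = E[M_N; event] for every N >= k, and
    these events are disjoint while E[M_N] = 1. *)
Lemma ville_gaussian (c : R) :
  P [set w | exists n, c <= log_martingale n w]%R <= (expR (- c))%:E.
Proof.
pose E n := [set w | c <= log_martingale n w]%R.
have pastE k n : (k <= n)%N -> <<s cylinders W n >> (E k).
  move=> kn.
  have := measurable_log_martingale_past kn measurableT (measurable_itv `[c, +oo[).
  rewrite setTI; congr (<<s _ >> _); apply/seteqP; split => w /=;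
    by rewrite in_itv/= andbT.
(* seqDU E k is the event that the level is first reached at time k. *)
have pastD k n : (k <= n)%N -> <<s cylinders W n >> (seqDU E k).
  move=> kn; rewrite /seqDU.
  apply: (@measurableD _ (g_sigma_algebraType (cylinders W n))); first exact: pastE.
  apply: (@bigsetU_measurable _ (g_sigma_algebraType (cylinders W n))) => i _.
  by apply: pastE; exact: (leq_trans (ltnW (ltn_ord i))).
have mD k : measurable (seqDU E k) by apply: past_measurable (pastD k k _).
have stop k N : (k <= N)%N ->
    \int[P]_(w in seqDU E k) (expR (log_martingale N w))%:E =
    \int[P]_(w in seqDU E k) (expR (log_martingale k w))%:E.
  elim: N => [|N IH]; first by rewrite leqn0 => /eqP ->.
  rewrite leq_eqVlt => /predU1P[->//|]; rewrite ltnS => kN.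
  by rewrite integral_martingaleS ?IH//; exact: pastD.
have mM N : measurable_fun setT (fun w => (expR (log_martingale N w))%:E).
  apply/measurable_EFinP; apply: measurableT_comp => //.
  exact: measurable_log_martingale.
have first_passage k : (expR c)%:E * P (seqDU E k) <=
    \int[P]_(w in seqDU E k) (expR (log_martingale k w))%:E.
  rewrite -integral_cst//; apply: ge0_le_integral => //.
  - by move=> w _; rewrite lee_fin expR_ge0.
  - exact: measurable_funTS.
  - by move=> w [+ _]; rewrite /E/= lee_fin ler_expR.
rewrite (_ : [set w | _] = \bigcup_n E n); last first.
  by apply/seteqP; split=> w [n]; [exists n|exists n].
rewrite seqDU_bigcup_eq measure_semi_bigcup//; last exact: bigcupT_measurable.
apply: lime_le; first exact: is_cvg_nneseries.
apply: nearW => N.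
rewrite expRN -[leRHS]mule1 lee_pdivlMl ?expR_gt0//.
rewrite ge0_sume_distrr//.
apply: (@le_trans _ _ (\sum_(0 <= k < N)
    \int[P]_(w in seqDU E k) (expR (log_martingale N w))%:E)).
  rewrite big_seq_cond [leRHS]big_seq_cond.
  apply: lee_sum => k; rewrite mem_index_iota => /andP[/andP[_ kN] _].
  by rewrite stop; [exact: first_passage|exact: ltnW].
rewrite -ge0_integral_bigsetU//.
- rewrite -(expectation_martingale N).
  apply: ge0_subset_integral => //.
  exact: bigsetU_measurable.
- by rewrite iota_uniq.
- exact: sub_trivIset (@subsetT _ _) (trivIset_seqDU E).
- exact: measurable_funTS.
Qed.

End gaussian_walk.

(** * The settling time *)

(** As e^x >= 1 + x, each term times x is at most the decrease of exp (- N x) at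
    that step. *)
Lemma geometric_sum_expR (R : realType) (x : R) N : 0 < x ->
  \sum_(0 <= k < N) expR (- (k.+1%:R * x)) <= x^-1.
Proof.
move=> x0.
suff : (\sum_(0 <= k < N) expR (- (k.+1%:R * x))) * x <= 1 - expR (- (N%:R * x)).
  move=> h; rewrite -[leRHS]mul1r ler_pdivlMr//; apply: le_trans h _.
  by rewrite gerBl expR_ge0.
elim: N => [|N IH]; first by rewrite big_geq// !mul0r oppr0 expR0 subrr.
rewrite big_nat_recr//= mulrDl; apply: le_trans (lerD IH (lexx _)) _.
have -> : expR (- (N%:R * x)) = expR (- (N.+1%:R * x)) * expR x.
  by rewrite -expRD; congr expR; rewrite -natr1; ring.
have := expR_ge1Dx x; have := expR_gt0 (- (N.+1%:R * x)).
set q := expR (- _); set y := expR x => q0 yx.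
by nra.
Qed.

Section settling.
Context d (Omega : measurableType d) (R : realType) (P : probability Omega R)
  (W : nat -> {RV P >-> R}).
Hypothesis hW : iid_standard_gaussian W.

Lemma emp_mean_walk n w : emp_mean W n w = walk W n w / n%:R.
Proof. by rewrite /emp_mean mulrC. Qed.

Lemma measurable_emp_mean n : measurable_fun setT (emp_mean W n).
Proof. by apply: measurable_funM => //; exact: measurable_walk. Qed.

Lemma measurable_ville_event (l c : R) :
  measurable [set w | exists n, c <= log_martingale W l n w].
Proof.
rewrite (_ : [set w | _] = \bigcup_n [set w | c <= log_martingale W l n w]).
  apply: bigcupT_measurable => n; rewrite -[X in measurable X]setTI.
  apply: measurable_fun_le => //; exact: measurable_log_martingale.
by apply/seteqP; split=> w [n]; [exists n|exists n].
Qed.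

Lemma ville_subset (l c : R) (A : set Omega) : measurable A ->
  (forall w, A w -> exists n, c <= log_martingale W l n w) ->
  (P A <= (expR (- c))%:E)%E.
Proof.
move=> mA AE; apply: le_trans (ville_gaussian l hW c).
by apply: le_measure; rewrite ?inE//; exact: measurable_ville_event.
Qed.

Definition late_deviation (e : R) (t : nat) : set Omega :=
  [set w | exists2 s, (t <= s)%N & e <= `|emp_mean W s w|].

Lemma measurable_late_deviation e t : measurable (late_deviation e t).
Proof.
rewrite (_ : late_deviation e t =
    \bigcup_(s in [set s | (t <= s)%N]) [set w | e <= `|emp_mean W s w|]).
  apply: bigcup_measurable => s _; rewrite -[X in measurable X]setTI.
  apply: measurable_fun_le => //.
  by apply: measurableT_comp => //; exact: measurable_emp_mean.
by apply/seteqP; split=> w [s]; exists s.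
Qed.

(** If S_s >= s e for some s >= t then e S_s - s e^2/2 >= t e^2/2: the line of
    slope e is crossed by the martingale of parameter e.  The parameter - e
    takes care of the negative deviations. *)
Lemma late_deviation_prob (e : R) (t : nat) : 0 < e -> (1 <= t)%N ->
  (P (late_deviation e t) <= (2 * expR (- (t%:R * (e ^+ 2 / 2))))%:E)%E.
Proof.
move=> e0 t1.
pose side (l : R) := [set w | exists2 s, (t <= s)%N & e ^+ 2 <= l * emp_mean W s w].
have mside l : measurable (side l).
  rewrite (_ : side l = \bigcup_(s in [set s | (t <= s)%N])
      [set w | e ^+ 2 <= l * emp_mean W s w]).
    apply: bigcup_measurable => s _; rewrite -[X in measurable X]setTI.
    apply: measurable_fun_le => //.
    by apply: measurable_funM => //; exact: measurable_emp_mean.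
  by apply/seteqP; split=> w [s]; exists s.
have Pside l : l ^+ 2 = e ^+ 2 ->
    (P (side l) <= (expR (- (t%:R * (e ^+ 2 / 2))))%:E)%E.
  move=> le2; apply: (@ville_subset l) => // w [s ts sl]; exists s.
  have s0 : 0 < s%:R :> R by rewrite ltr0n (leq_trans t1).
  rewrite /log_martingale le2.
  have lS : s%:R * e ^+ 2 <= l * walk W s w.
    move: sl; rewrite emp_mean_walk mulrA ler_pdivlMr//; lra.
  have ts' : t%:R <= s%:R :> R by rewrite ler_nat.
  have : t%:R * (e ^+ 2 / 2) <= s%:R * (e ^+ 2 / 2).
    by apply: ler_wpM2r => //; rewrite divr_ge0// sqr_ge0.
  lra.
apply: (@le_trans _ _ (P (side e `|` side (- e)))).
  apply: le_measure; rewrite ?inE; [exact: measurable_late_deviation|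
    exact: measurableU|].
  move=> w [s ts]; rewrite ler_normr => /orP[h|h]; [left|right];
    by exists s => //; nra.
apply: le_trans (measureU2 _ (mside _) (mside _)) _.
rewrite mulr_natl mulr2n EFinD; apply: leeD; apply: Pside => //.
by rewrite sqrrN.
Qed.

(** If t is the first time without a deviation of size e from t on, then the
    supremum from t on is at most e < eps, so the settling time is at most t,
    and the t - 1 earlier times all contribute to the series. *)
Lemma le_settling_time (e eps : R) (w : Omega) : e < eps ->
  (settling_time W eps w <=
   1 + \sum_(0 <= k <oo) (\1_(late_deviation e k.+1) w : R)%:E)%E.
Proof.
move=> e_eps.
set dev := (\sum_(0 <= k <oo) _)%E.
have dev_ge N : (forall k, (k < N)%N -> late_deviation e k.+1 w) ->
    ((N%:R)%:E <= dev)%E.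
  move=> late; apply: (@le_trans _ _
      (\sum_(0 <= k < N) (\1_(late_deviation e k.+1) w : R)%:E)%E); last first.
    by apply: nneseries_lim_ge => k _ _; rewrite lee_fin indicE.
  have -> : (N%:R)%:E = (\sum_(0 <= k < N) (1 : R)%:E)%E.
    by rewrite sumEFin sumr_const_nat subn0.
  rewrite big_seq_cond [leRHS]big_seq_cond; apply: lee_sum => k.
  rewrite mem_index_iota => /andP[/andP[_ kN] _].
  by rewrite lee_fin indicE mem_set//; exact: late.
have [[k nlate]|late] := pselect (exists k, ~ late_deviation e k.+1 w); last first.
  suff -> : dev = +oo%E by rewrite addey// leey.
  apply: eq_infty => r; have [r0|r0] := leP r 0.
    by apply: le_trans (dev_ge 0%N _) => //; rewrite lee_fin.
  apply: le_trans (dev_ge (Num.trunc r).+1 _).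
    by rewrite lee_fin; apply: ltW; exact: truncnS_gt.
  by move=> k _; apply: contrapT => nl; apply: late; exists k.
have ex : exists k, `[< ~ late_deviation e k.+1 w >] by exists k; apply/asboolP.
case: (ex_minnP ex) => m /asboolP nm minm.
apply: (@le_trans _ _ (m.+1%:R)%:E); last first.
  rewrite -natr1 addrC EFinD; apply: leeD => //; apply: dev_ge => i im.
  apply: contrapT => /asboolP /minm; by rewrite leqNgt im.
apply: ereal_inf_lbound; exists m.+1 => //; split => //.
apply: (@le_lt_trans _ _ e%:E); last by rewrite lte_fin.
apply: ge_ereal_sup => _ [s ms <-]; rewrite lee_fin leNgt.
by apply/negP => /ltW h; apply: nm; exists s.
Qed.

Lemma settling_time_ge0 (eps : R) (w : Omega) : (0 <= settling_time W eps w)%E.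
Proof. by apply: le_ereal_inf_tmp => _ [t _ <-]; rewrite lee_fin. Qed.

Lemma expectation_settling_time (eps : R) : 0 < eps ->
  (\int[P]_w settling_time W eps w <= (1 + 9 / eps ^+ 2)%:E)%E.
Proof.
move=> eps0.
(* For this e the bound 1 + 4 / e^2 is the required one. *)
pose e := 2 / 3 * eps.
have e0 : 0 < e by rewrite /e mulr_gt0.
pose dev w := (\sum_(0 <= k <oo) (\1_(late_deviation e k.+1) w : R)%:E)%E.
have mind k : measurable_fun setT
    (fun w => (\1_(late_deviation e k.+1) w : R)%:E).
  by apply/measurable_EFinP; apply: measurable_indic; exact: measurable_late_deviation.
have ind0 k w : (0 <= (\1_(late_deviation e k.+1) w : R)%:E)%E.
  by rewrite lee_fin indicE.
have dev0 w : (0 <= dev w)%E by exact: nneseries_ge0.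
have mdev : measurable_fun setT dev.
  by apply: ge0_emeasurable_sum => //.
apply: (@le_trans _ _ (\int[P]_w (1 + dev w))%E).
  (* The settling time is not known to be measurable, so the integrals are
     compared through the simple functions below each integrand. *)
  rewrite !ge0_integralTE//; last 2 first.
  - by move=> w; exact: adde_ge0.
  - by move=> w; exact: settling_time_ge0.
  apply: le_ereal_sup => _ [h hle <-]; exists h => // w.
  apply: le_trans (hle w) (le_settling_time _ _).
  by rewrite /e; lra.
rewrite ge0_integralD//.
rewrite integral_cst//= mul1e probability_setT EFinD; apply: leeD => //.
rewrite integral_nneseries//; apply: lime_le.
  by apply: is_cvg_nneseries => k _ _; exact: integral_ge0.
apply: nearW => N.
apply: (@le_trans _ _
    (\sum_(0 <= k < N) (2 * expR (- (k.+1%:R * (e ^+ 2 / 2))))%:E)%E).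
  apply: lee_sum => k _; rewrite integral_indic//; last exact: measurable_late_deviation.
  by rewrite setIT; exact: late_deviation_prob.
rewrite sumEFin lee_fin -mulr_sumr.
apply: (@le_trans _ _ (2 * (e ^+ 2 / 2)^-1)).
  by rewrite ler_pM2l//; apply: geometric_sum_expR; rewrite divr_gt0// exprn_gt0.
rewrite /e le_eqVlt; apply/orP; left; apply/eqP; field.
by rewrite gt_eqF.
Qed.

End settling.

(** * Real estimates for the sum of exceedance probabilities *)

Section gaussian_sums.
Context (R : realType).

(** The Gaussian function decreases on the half-line, so its values at the right
    endpoints give a lower Riemann sum of the half Gaussian integral. *)
Lemma gauss_riemann_sum (y : nat -> R) N :
  0 <= y 0%N -> (forall k, y k <= y k.+1) ->
  \sum_(0 <= k < N) (y k.+1 - y k) * gauss_fun (y k.+1) <= Num.sqrt pi / 2.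
Proof.
move=> y0 ynd.
have yk0 k : 0 <= y k by elim: k => // k IH; exact: le_trans (ynd k).
have mg (D : set (measurableTypeR R)) :
    measurable_fun D (fun x : measurableTypeR R => (gauss_fun (x : R))%:E).
  by apply/measurable_EFinP; apply: measurable_funTS; exact: measurable_gauss_fun.
have g0 (x : R) : (0 <= (gauss_fun x)%:E)%E by rewrite lee_fin gauss_fun_ge0.
rewrite -lee_fin -integral0y_gauss.
apply: (@le_trans _ _
    (\int[lebesgue_measure]_(x in `[0%R, y N]) (gauss_fun x)%:E)%E); last first.
  apply: ge0_subset_integral => // x /=.
  by rewrite !in_itv/= => /andP[->].
elim: N => [|N IH]; first by rewrite big_geq// integral_ge0.
rewrite big_nat_recr//= EFinD.
rewrite (@itv_bndbnd_setU _ _ _ (BRight (y N))) ?bnd_simp//.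
rewrite ge0_integral_setU//; last first.
  rewrite disj_set2E; apply/eqP/seteqP; split => // x [] /=.
  by rewrite !in_itv/= => /andP[_ xy] /andP[yx _]; have := lt_le_trans yx xy; rewrite ltxx.
apply: leeD => //.
apply: (@le_trans _ _ (\int[lebesgue_measure]_(x in `]y N, y N.+1])
    (cst (gauss_fun (y N.+1))%:E x))%E).
  rewrite integral_cst//= lebesgue_measure_itv/= lte_fin.
  case: ltP => h; first by rewrite -EFinB -EFinM mulrC.
  by rewrite mule0 lee_fin; rewrite (le_anti (introT andP (conj h (ynd N)))) subrr mul0r.
apply: ge0_le_integral => //.
- by move=> x _ /=.
- move=> x /=; rewrite in_itv/= => /andP[yx xy]; rewrite lee_fin ler_expR lerN2.
  by rewrite ler_pXn2r// nnegrE// (le_trans _ (ltW yx)).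
Qed.

Lemma std_gauss_riemann_sum (x : nat -> R) N :
  0 <= x 0%N -> (forall k, x k <= x k.+1) ->
  \sum_(0 <= k < N) (x k.+1 - x k) * expR (- (x k.+1 ^+ 2 / 2)) <=
  Num.sqrt (2 * pi) / 2.
Proof.
move=> x0 xnd; have s2 : 0 < Num.sqrt 2 :> R by rewrite sqrtr_gt0.
have := @gauss_riemann_sum (fun k => x k / Num.sqrt 2) N.
rewrite /= divr_ge0// => /(_ isT) /= => h.
have {}h : \sum_(0 <= k < N) (x k.+1 / Num.sqrt 2 - x k / Num.sqrt 2) *
    gauss_fun (x k.+1 / Num.sqrt 2) <= Num.sqrt pi / 2.
  by apply: h => k; rewrite ler_pM2r// invr_gt0.
rewrite sqrtrM// -mulrA; rewrite -ler_pdivrMl//; apply: le_trans h.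
rewrite mulr_sumr le_eqVlt; apply/orP; left; apply/eqP.
apply: eq_bigr => k _; rewrite -mulrBl mulrA [_^-1 * _]mulrC; congr (_ * expR _).
by rewrite expr_div_n sqr_sqrtr.
Qed.

(** Comparison of the sum with the integral of
    exp (- (D sqrt s - c)^2 / 2) over s: the substitution x = D sqrt s - c turns
    it into 2 D^-2 times the integral of (x + c) exp (- x^2 / 2).  The
    comparison is made term by term, from e^t >= 1 + t for the part x
    exp (- x^2 / 2) and as a Riemann sum for the other one. *)
Lemma shifted_gaussian_sum (D c : R) (m N : nat) :
  0 < D -> 0 <= c -> c <= D * Num.sqrt m%:R ->
  \sum_(0 <= k < N) expR (- ((D * Num.sqrt (m + k).+1%:R - c) ^+ 2 / 2)) <=
  2 / D ^+ 2 * (1 + c * (Num.sqrt (2 * pi) / 2)).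
Proof.
move=> D0 c0 cm.
pose x k := D * Num.sqrt (m + k)%:R - c.
have x0 : 0 <= x 0%N by rewrite /x addn0 subr_ge0.
have xnd k : x k <= x k.+1.
  by rewrite lerD2r ler_pM2l// ler_wsqrtr// ler_nat leq_add2l.
have xk0 k : 0 <= x k by elim: k => // k IH; exact: le_trans (xnd k).
have sqx k : (x k + c) ^+ 2 = D ^+ 2 * (m + k)%:R.
  by rewrite /x subrK exprMn sqr_sqrtr.
have D20 : 0 < D ^+ 2 by rewrite exprn_gt0.
rewrite mulrC -ler_pdivrMr; last by rewrite divr_gt0.
apply: (@le_trans _ _ (\sum_(0 <= k < N)
   ((expR (- (x k ^+ 2 / 2)) - expR (- (x k.+1 ^+ 2 / 2))) +
    c * ((x k.+1 - x k) * expR (- (x k.+1 ^+ 2 / 2)))))).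
  rewrite mulr_suml; apply: ler_sum => k _.
  rewrite -addnS -/(x k.+1) invf_div.
  have -> : expR (- (x k ^+ 2 / 2)) =
      expR ((x k.+1 ^+ 2 - x k ^+ 2) / 2) * expR (- (x k.+1 ^+ 2 / 2)).
    by rewrite -expRD; congr expR; field.
  have := expR_ge1Dx ((x k.+1 ^+ 2 - x k ^+ 2) / 2).
  have := expR_gt0 (- (x k.+1 ^+ 2 / 2)).
  have : (x k.+1 + c) ^+ 2 - (x k + c) ^+ 2 = D ^+ 2.
    by rewrite !sqx addnS -natr1; ring.
  move: (expR (- _)) (expR ((_ - _) / 2)) => E F Dx E0 F1.
  have -> : D ^+ 2 / 2 = (x k.+1 ^+ 2 - x k ^+ 2) / 2 + c * (x k.+1 - x k).
    by rewrite -Dx; field.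
  have : (1 + (x k.+1 ^+ 2 - x k ^+ 2) / 2) * E <= F * E by rewrite ler_pM2r.
  lra.
rewrite big_split/= -mulr_sumr; apply: lerD; last first.
  by apply: ler_wpM2l => //; exact: std_gauss_riemann_sum.
rewrite (telescope_sumr_eq (fun k => - expR (- (x k ^+ 2 / 2))))//; last first.
  by move=> k _; rewrite opprK addrC.
rewrite opprK addrC lerBlDr; apply: (@le_trans _ _ 1); last by rewrite lerDl expR_ge0.
by rewrite -expR0 ler_expR oppr_le0 divr_ge0// sqr_ge0.
Qed.

(** From exp (- a / 4) >= 1 - a / 4 and 7/5 < sqrt 2 <= sqrt pi; this is the range
    of T in which bounding every probability by 1 is enough. *)
Lemma expR_le_add_sqrt (a : R) : 0 <= a <= 1 -> expR a <= 1 + a + Num.sqrt (pi * a).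
Proof.
move=> /andP[a0 a1].
have sq : 7 / 5 * a <= Num.sqrt (pi * a).
  rewrite -[leLHS]ger0_norm; last by rewrite mulr_ge0.
  rewrite -sqrtr_sqr ler_wsqrtr//.
  by have := pi_ge2 R; nra.
have q0 : 0 < 1 - a / 4 by lra.
have : expR (- (a / 4)) ^+ 4 = (expR a)^-1.
  by rewrite -expRM_natl -expRN; congr expR; field.
have := expR_ge1Dx (- (a / 4)).
move=> h1 h2.
have h3 : (1 - a / 4) ^+ 4 <= (expR a)^-1.
  by rewrite -h2 ler_pXn2r// ?nnegrE ?expR_ge0 ?(ltW q0).
have {}h3 : (1 - a / 4) ^+ 4 * expR a <= 1.
  by rewrite -ler_pdivlMr ?expR_gt0// mul1r.
apply: le_trans (_ : 1 + a + 7 / 5 * a <= _); last by rewrite lerD2l.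
have poly : 1 <= (1 - a / 4) ^+ 4 * (1 + a + 7 / 5 * a).
  pose b := a / 4.
  have -> : (1 - a / 4) ^+ 4 * (1 + a + 7 / 5 * a) =
     (1 - b) ^+ 4 * (1 + 48 / 5 * b) by rewrite /b; field.
  have b0 : 0 <= b by rewrite /b; lra.
  have b1 : b <= 1 / 4 by rewrite /b; lra.
  have b2 : 0 <= b ^+ 2 * (1 / 4 - b) by rewrite mulr_ge0 ?sqr_ge0//; lra.
  have b4 : 0 <= b ^+ 4 by rewrite exprn_ge0.
  have sq1 : 0 <= (1 / 4 - b) ^+ 2 by exact: sqr_ge0.
  have -> : (1 - b) ^+ 4 * (1 + 48 / 5 * b) = 1 + b *
    (28 / 5 - 162 / 5 * b + 268 / 5 * b ^+ 2 - 187 / 5 * b ^+ 3 + 48 / 5 * b ^+ 4).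
    by field.
  rewrite lerDl mulr_ge0//; nra.
have p0 : 0 < (1 - a / 4) ^+ 4 by rewrite exprn_gt0.
by rewrite -(ler_pM2l p0); exact: le_trans poly.
Qed.

End gaussian_sums.

(** * Indices above the gap *)

Section index_exceedance.
Context d (Omega : measurableType d) (R : realType) (P : probability Omega R)
  (W : nat -> {RV P >-> R}).
Hypothesis hW : iid_standard_gaussian W.

Lemma chernoff_walk (A : set Omega) (n : nat) (x : R) : (1 <= n)%N -> 0 <= x ->
  measurable A -> (forall w, A w -> x * Num.sqrt n%:R <= walk W n w) ->
  (P A <= (expR (- (x ^+ 2 / 2)))%:E)%E.
Proof.
move=> n1 x0 mA AS.
have s0 : 0 < Num.sqrt n%:R :> R by rewrite sqrtr_gt0 ltr0n.
(* The parameter minimizing the exponent at the fixed time n. *)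
apply: (@ville_subset _ _ _ _ _ hW (x / Num.sqrt n%:R)) => // w /AS h.
exists n; rewrite /log_martingale expr_div_n sqr_sqrtr//.
have -> : n%:R * (x ^+ 2 / n%:R / 2) = x ^+ 2 / 2 :> R.
  by field; rewrite pnatr_eq0 -lt0n.
have : x / Num.sqrt n%:R * (x * Num.sqrt n%:R) <= x / Num.sqrt n%:R * walk W n w.
  by apply: ler_wpM2l => //; rewrite divr_ge0// ltW.
have -> : x / Num.sqrt n%:R * (x * Num.sqrt n%:R) = x ^+ 2.
  by field; rewrite gt_eqF.
lra.
Qed.

Context (Delta : R) (T : nat).
Hypotheses (Delta0 : 0 < Delta) (hT : (1 <= T)%N).

Definition index_exceeds (n : nat) : set Omega :=
  [set w | Delta <= emp_mean W n w +
                    Num.sqrt (2 / n%:R * ln (T%:R / n%:R))].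

Lemma measurable_index_exceeds n : measurable (index_exceeds n).
Proof.
rewrite -[X in measurable X]setTI; apply: measurable_fun_le => //.
by apply: measurable_funD => //; exact: measurable_emp_mean.
Qed.

Let l : R := ln (T%:R * Delta ^+ 2 / 2).

(** For n >= 2 / Delta^2 the bonus is at most sqrt (2 l / n); hence the event
    requires a deviation of sqrt n Delta - sqrt (2 l) standard units. *)
Lemma index_exceeds_prob n : (1 <= n)%N -> 1 <= l ->
  2 * l / Delta ^+ 2 <= n%:R ->
  (P (index_exceeds n) <=
   (expR (- ((Delta * Num.sqrt n%:R - Num.sqrt (2 * l)) ^+ 2 / 2)))%:E)%E.
Proof.
move=> n1 l1 un.
have n0 : 0 < n%:R :> R by rewrite ltr0n.
have s0 : 0 < Num.sqrt n%:R :> R by rewrite sqrtr_gt0.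
have T0 : 0 < T%:R :> R by rewrite ltr0n.
have D20 : 0 < Delta ^+ 2 by rewrite exprn_gt0.
have un' : 2 * l <= n%:R * Delta ^+ 2 by rewrite -ler_pdivrMr.
apply: (@chernoff_walk _ n) => //; last 2 first.
- exact: measurable_index_exceeds.
- move=> w; rewrite /index_exceeds/= emp_mean_walk => h.
  have bonus : Num.sqrt (2 / n%:R * ln (T%:R / n%:R)) <= Num.sqrt (2 * l) / Num.sqrt n%:R.
    rewrite -sqrtrV; last exact: ltW.
    rewrite -sqrtrM; last by rewrite mulr_ge0//; lra.
    apply: ler_wsqrtr; rewrite (mulrAC 2 l).
    apply: ler_wpM2l; first by rewrite divr_ge0// ltW.
    rewrite ler_ln ?posrE ?divr_gt0 ?mulr_gt0//.
    rewrite ler_pdivrMr// -2!mulrA ler_peMr ?(ltW T0)//; lra.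
  have : (Delta - Num.sqrt (2 * l) / Num.sqrt n%:R) * n%:R <= walk W n w.
    by rewrite -ler_pdivlMr//; lra.
  rewrite -{2}(sqr_sqrtr (ltW n0)); apply: le_trans.
  rewrite le_eqVlt; apply/orP; left; apply/eqP; field.
  by rewrite gt_eqF.
rewrite subr_ge0 -ler_sqr ?nnegrE ?sqrtr_ge0 ?mulr_ge0 ?(ltW Delta0)//.
rewrite exprMn !sqr_sqrtr//; lra.
Qed.

Lemma sum_index_exceeds_prob : 2 <= T%:R * Delta ^+ 2 ->
  (\sum_(1 <= n < T.+1) P (index_exceeds n) <=
   (2 * l / Delta ^+ 2 + 2 * Num.sqrt (pi * l) / Delta ^+ 2
    + 2 / Delta ^+ 2 + 1)%:E)%E.
Proof.
move=> TD.
have D20 : 0 < Delta ^+ 2 by rewrite exprn_gt0.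
have l0 : 0 <= l by rewrite /l ln_ge0// ler_pdivlMr// mul1r.
have P1 m : (\sum_(1 <= n < m.+1) P (index_exceeds n) <= (m%:R)%:E)%E.
  have -> : (m%:R)%:E = (\sum_(1 <= n < m.+1) (1 : R)%:E)%E.
    by rewrite sumEFin sumr_const_nat subn1.
  by apply: lee_sum => n _; apply: probability_le1; exact: measurable_index_exceeds.
have [l1|/ltW l1] := leP l 1.
  apply: le_trans (P1 T) _; rewrite lee_fin.
  have TE : T%:R = 2 / Delta ^+ 2 * expR l.
    rewrite /l lnK; last by rewrite posrE; lra.
    by field; rewrite gt_eqF.
  have := expR_le_add_sqrt (introT andP (conj l0 l1)).
  rewrite -(@ler_pM2l _ (2 / Delta ^+ 2)); last by rewrite divr_gt0.
  rewrite -TE => h; apply: le_trans h _.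
  rewrite -subr_ge0 (_ : _ - _ = 1) ?ler01//.
  by field; rewrite gt_eqF.
pose u := 2 * l / Delta ^+ 2.
have u0 : 0 <= u by rewrite /u divr_ge0 ?ltW// mulr_gt0//; lra.
(* The terms up to m + 1, the first integer above u, are bounded by 1. *)
pose m := Num.trunc u.
have mu : m%:R <= u by rewrite truncn_le.
have um : u < m.+1%:R by exact: truncnS_gt.
(* The longer sum splits at m + 2 even when T is smaller than m + 2. *)
apply: (@le_trans _ _ (\sum_(1 <= n < m.+2 + T) P (index_exceeds n))%E).
  rewrite (@big_cat_nat _ _ _ T.+1 1 (m.+2 + T))//=; last by rewrite addSn ltnS leq_addl.
  by rewrite leeDl// sume_ge0.
rewrite (@big_cat_nat _ _ _ m.+2)//=; last by rewrite leq_addr.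
pose c := Num.sqrt (2 * l).
apply: (@le_trans _ _ ((m.+1%:R)%:E + (2 / Delta ^+ 2 *
    (1 + c * (Num.sqrt (2 * pi) / 2)))%:E)%E).
  apply: leeD; first exact: P1.
  apply: le_trans (_ : _ <= (\sum_(0 <= k < T)
      expR (- ((Delta * Num.sqrt (m.+1 + k).+1%:R - c) ^+ 2 / 2)))%:E)%E _.
    rewrite -{1}(add0n m.+2) big_addn addKn -sumEFin.
    apply: lee_sum => k _; rewrite -addSn [(k + _)%N]addnC; apply: index_exceeds_prob => //.
    apply: le_trans (ltW um) _.
    by rewrite ler_nat addSn ltnS ltnW// ltnS leq_addr.
  rewrite lee_fin; apply: shifted_gaussian_sum => //; first exact: sqrtr_ge0.
  rewrite -ler_sqr ?nnegrE ?sqrtr_ge0 ?mulr_ge0 ?(ltW Delta0)//.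
  rewrite exprMn !sqr_sqrtr//; last by rewrite mulr_ge0.
  move: um; rewrite /u ltr_pdivrMr//; lra.
rewrite -EFinD lee_fin -natr1 -/u.
have -> : c * (Num.sqrt (2 * pi) / 2) = Num.sqrt (pi * l).
  rewrite /c mulrA -sqrtrM; last by rewrite mulr_ge0.
  have -> : 2 * l * (2 * pi) = 2 ^+ 2 * (pi * l) :> R by ring.
  by rewrite sqrtrM// sqrtr_sqr ger0_norm// mulrC mulKf.
have -> : 2 / Delta ^+ 2 * (1 + Num.sqrt (pi * l)) =
  2 * Num.sqrt (pi * l) / Delta ^+ 2 + 2 / Delta ^+ 2 by ring.
lra.
Qed.

End index_exceedance.

(** * Real estimates for the peeling argument *)

Section peeling_bounds.
Context (R : realType).

(** The map z |-> z / (1 + z) increases by at least (1 - r^-1) z / (1 + z)^2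
    along each step of a geometric progression. *)
Lemma geometric_peeling_sum (r a : R) K : 1 < r -> 0 < a ->
  \sum_(0 <= k < K) (a * r ^+ k.+1 / (1 + a * r ^+ k.+1) ^+ 2) <= r / (r - 1).
Proof.
move=> r1 a0; have r0 : 0 < r by apply: lt_trans r1.
pose z k := a * r ^+ k.
have z0 k : 0 < z k by rewrite mulr_gt0// exprn_gt0.
have s0 : 0 < r / (r - 1) by rewrite divr_gt0// subr_gt0.
rewrite -[leRHS]mulr1 -ler_pdivrMl//.
apply: (@le_trans _ _ (\sum_(0 <= k < K) (z k.+1 / (1 + z k.+1) - z k / (1 + z k)))).
  rewrite mulr_sumr; apply: ler_sum => k _; rewrite -/(z k.+1).
  have -> : (r / (r - 1))^-1 * (z k.+1 / (1 + z k.+1) ^+ 2) =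
      (z k.+1 - z k) / (1 + z k.+1) * (1 + z k.+1)^-1.
    rewrite /z exprS; field.
    by rewrite !gt_eqF ?subr_gt0//= ltr_wpDr// -exprS; exact: ltW (z0 k.+1).
  have -> : z k.+1 / (1 + z k.+1) - z k / (1 + z k) =
      (z k.+1 - z k) / (1 + z k.+1) * (1 + z k)^-1.
    by field; rewrite !gt_eqF// addr_gt0.
  have zz : z k <= z k.+1 by rewrite ler_pM2l// ler_eXn2l// ltnW.
  apply: ler_wpM2l; first by rewrite divr_ge0 ?subr_ge0// addr_ge0// ltW.
  by rewrite lef_pV2 ?posrE ?addr_gt0// lerD2l.
rewrite telescope_sumr//.
have zK : z K / (1 + z K) <= 1 by rewrite ler_pdivrMr ?addr_gt0// mul1r lerDr.
have : 0 <= z 0%N / (1 + z 0%N) by rewrite divr_ge0// ltW// addr_gt0.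
lra.
Qed.

(** The exponent of a block.  Since 1 - 4 r / (1 + r)^2 = ((r - 1) / (r + 1))^2
    is at most 1 / (4 L), replacing x sqrt s by its chord multiplies the bound
    exp (- (L - 2 ln w)) = exp (- L) w^2 by at most e^(1/4) if w >= 1, and by at
    most e^(1/4) w^-1 if w < 1.  The term in x contributes exp (- w), as x is
    bounded below, and this beats the powers of w. *)
Lemma block_exponent_bound (L w : R) (r := 1 + (Num.sqrt L)^-1)
    (x := Num.sqrt (2 * (L - 2 * ln w))) :
  2 <= L -> 0 < w -> 1 <= L - 2 * ln w ->
  expR (- (4 * r / (1 + r) ^+ 2 * (L - 2 * ln w) + 2 * x * w / (1 + r))) <=
  27 * expR (- L) * (w / (1 + w) ^+ 2).
Proof.
move=> L2 w0 M1.
have sL0 : 0 < Num.sqrt L by rewrite sqrtr_gt0; lra.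
pose q := (Num.sqrt L)^-1.
have q0 : 0 < q by rewrite invr_gt0.
have qq : q ^+ 2 = L^-1 by rewrite exprVn sqr_sqrtr//; lra.
have q2 : q ^+ 2 <= 1 / 2.
  by rewrite qq div1r lef_pV2 ?posrE//; lra.
have r_def : r = 1 + q by [].
have r0 : 0 < 1 + r by rewrite r_def; lra.
have x2 : 2 <= x ^+ 2 by rewrite sqr_sqrtr; lra.
have x0 : 0 <= x by exact: sqrtr_ge0.
have xr : w <= 2 * x * w / (1 + r).
  rewrite ler_pdivlMr// mulrC ler_wpM2r ?(ltW w0)//; rewrite r_def.
  have q34 : q <= 3 / 4 by nra.
  have x75 : 7 / 5 <= x by nra.
  lra.
(* dl is the part of the exponent lost to the chord. *)
pose dl := 1 - 4 * r / (1 + r) ^+ 2.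
have dlE : dl = (q / (2 + q)) ^+ 2.
  by rewrite /dl r_def; field; rewrite gt_eqF//; lra.
have dl0 : 0 <= dl by rewrite dlE sqr_ge0.
have dlL : dl * L <= 1 / 4.
  rewrite dlE expr_div_n qq mulrAC mulVf ?mul1r; last by rewrite gt_eqF//; lra.
  rewrite lef_pV2 ?posrE ?exprn_gt0//; nra.
have dl8 : dl <= 1 / 8 by nra.
pose j := ln w; have wE : w = expR j by rewrite lnK.
have wj : expR (Num.max j 0) <= 1 + w.
  by case: (leP j 0) => _; [rewrite expR0|rewrite -wE]; lra.
have key : - (4 * r / (1 + r) ^+ 2 * (L - 2 * ln w) + 2 * x * w / (1 + r)) <=
    - L + j + Num.max j 0 + (1 / 4 - w).
  have -> : 4 * r / (1 + r) ^+ 2 = 1 - dl by rewrite /dl; ring.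
  rewrite -/j; have : dl * (L - 2 * j) <= 1 / 4 - j + Num.max j 0.
    rewrite mulrBr mulrCA; case: (leP j 0) => j0.
      have : 0 <= (1 / 8 - dl) * - j by rewrite mulr_ge0//; lra.
      lra.
    have : 0 <= dl * j by rewrite mulr_ge0// ltW.
    lra.
  lra.
apply: (@le_trans _ _ (expR (- L + j + Num.max j 0 + (1 / 4 - w)))).
  by rewrite ler_expR.
rewrite 3!expRD -wE.
have w1 : 0 < 1 + w by lra.
(* The maximum of (1 + w)^3 exp (- w) is at w = 2, where the tangent is taken. *)
have cube : (1 + w) ^+ 3 * expR (1 / 4 - w) <= 27.
  have h : (1 + w) / 3 <= expR ((w - 2) / 3).
    by have := expR_ge1Dx ((w - 2) / 3); lra.
  have : ((1 + w) / 3) ^+ 3 <= expR ((w - 2) / 3) ^+ 3.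
    by apply: lerXn2r => //; rewrite nnegrE ?expR_ge0// divr_ge0// ltW.
  rewrite -expRM_natl => h3.
  apply: (@le_trans _ _ (27 * (expR (3%:R * ((w - 2) / 3)) * expR (1 / 4 - w)))).
    rewrite mulrA ler_wpM2r ?expR_ge0//.
    move: h3; rewrite expr_div_n ler_pdivrMr ?exprn_gt0//; lra.
  rewrite -expRD ger_pMr// expR_le1; lra.
have Lw0 : 0 <= expR (- L) * w by rewrite mulr_ge0 ?expR_ge0 ?ltW.
apply: (@le_trans _ _ (expR (- L) * w * ((1 + w) * expR (1 / 4 - w)))).
  rewrite -[leLHS]mulrA; apply: ler_wpM2l => //.
  by apply: ler_wpM2r => //; exact: expR_ge0.
have -> : 27 * expR (- L) * (w / (1 + w) ^+ 2) =
    expR (- L) * w * (27 / (1 + w) ^+ 2) by ring.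
apply: ler_wpM2l => //; rewrite ler_pdivlMr ?exprn_gt0//.
by move: cube; rewrite !exprS expr0; lra.
Qed.

Lemma block_index_exists (r t : R) K : 1 < r -> 1 <= t -> t < r ^+ K ->
  exists2 k, (k < K)%N & r ^+ k <= t <= r * r ^+ k.
Proof.
move=> r1 t1 tK.
have ex : exists k, t < r ^+ k by exists K.
case: (ex_minnP ex) => -[|k] tk mink; first by move: tk; rewrite expr0 ltNge t1.
exists k; first exact: mink tK.
rewrite -exprS (ltW tk) andbT leNgt.
by apply/negP => /mink; rewrite ltnn.
Qed.

Lemma power_unbounded (r t : R) : 1 < r -> exists K, t < r ^+ K.
Proof.
move=> r1; have r0 : 0 < r - 1 by lra.
have bern n : 1 + n%:R * (r - 1) <= r ^+ n.
  elim: n => [|n IH]; first by rewrite mul0r addr0 expr0.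
  rewrite exprS; apply: (@le_trans _ _ (r * (1 + n%:R * (r - 1)))).
    rewrite -natr1; have : 0 <= n%:R * (r - 1) ^+ 2.
      by rewrite mulr_ge0// sqr_ge0.
    lra.
  by apply: ler_wpM2l => //; lra.
exists (Num.trunc (t / (r - 1))).+1; apply: lt_le_trans (bern _).
have := truncnS_gt (t / (r - 1)); rewrite ltr_pdivrMr//; lra.
Qed.

Lemma expR1_ge2 : 2 <= expR 1 :> R.
Proof. by have := expR_ge1Dx (1 : R); lra. Qed.

End peeling_bounds.

(** * Indices below zero *)

Section peeling.
Context d (Omega : measurableType d) (R : realType) (P : probability Omega R)
  (W : nat -> {RV P >-> R}).
Hypothesis hW : iid_standard_gaussian W.
Context (eps : R) (T : nat).
Hypotheses (eps0 : 0 < eps) (hT : (1 <= T)%N).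

Definition index_below (s : nat) (w : Omega) : Prop :=
  emp_mean W s w + Num.sqrt (2 / s%:R * ln (T%:R / s%:R)) + eps <= 0.

Lemma measurable_index_below s : measurable [set w | index_below s w].
Proof.
rewrite -[X in measurable X]setTI; apply: measurable_fun_le => //.
by do 2 apply: measurable_funD => //; exact: measurable_emp_mean.
Qed.

(** On the times s with sigma <= sqrt s <= r sigma the concave boundary
    x sqrt s is at least its chord, an affine function of s. *)
Lemma index_below_block (r sigma : R) (s : nat) (w : Omega)
    (x := Num.sqrt (2 * ln (T%:R / (r * sigma) ^+ 2)))
    (a := x * sigma * r / (1 + r)) (b := 2 * (x / (sigma * (1 + r)) + eps)) :
  (1 <= s)%N -> 0 < sigma -> 1 < r ->
  sigma <= Num.sqrt s%:R <= r * sigma ->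
  index_below s w -> a * b <= log_martingale W (- b) s w.
Proof.
move=> s1 sg0 r1 /andP[sg1 sg2]; rewrite /index_below emp_mean_walk => h.
have s0 : 0 < s%:R :> R by rewrite ltr0n.
have T0 : 0 < T%:R :> R by rewrite ltr0n.
have r0 : 0 < r by lra.
pose t := Num.sqrt s%:R : R.
have t0 : 0 < t by rewrite sqrtr_gt0.
have tt : t ^+ 2 = s%:R by rewrite sqr_sqrtr// ltW.
have x0 : 0 <= x by exact: sqrtr_ge0.
have b0 : 0 <= b by rewrite mulr_ge0// addr_ge0 ?(ltW eps0)// divr_ge0// mulr_ge0; lra.
have rs0 : 0 < r * sigma by rewrite mulr_gt0.
have bonus : x / t <= Num.sqrt (2 / s%:R * ln (T%:R / s%:R)).
  have -> : 2 / s%:R * ln (T%:R / s%:R) = s%:R^-1 * (2 * ln (T%:R / s%:R)) :> R by ring.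
  rewrite sqrtrM ?invr_ge0 ?(ltW s0)// sqrtrV ?(ltW s0)//.
  rewrite -/t [x / t]mulrC ler_wpM2l ?invr_ge0 ?(ltW t0)//.
  apply: ler_wsqrtr; rewrite ler_pM2l// ler_ln ?posrE ?divr_gt0 ?exprn_gt0//.
  rewrite ler_pM2l// lef_pV2 ?posrE ?exprn_gt0// -tt.
  by rewrite ler_sqr ?nnegrE ?(ltW t0)// ltW.
have chord : t ^+ 2 + r * sigma ^+ 2 <= t * (sigma + r * sigma).
  have : 0 <= (t - sigma) * (r * sigma - t) by rewrite mulr_ge0// subr_ge0.
  lra.
have crossing : a + s%:R * (b / 2) <= - walk W s w.
  apply: (@le_trans _ _ (x * t + s%:R * eps)).
    have -> : a + s%:R * (b / 2) =
        x * ((t ^+ 2 + r * sigma ^+ 2) / (sigma + r * sigma)) + s%:R * eps.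
      rewrite /a /b tt; field.
      by rewrite !gt_eqF//; nra.
    rewrite lerD2r ler_wpM2l// ler_pdivrMr//; nra.
  have : (walk W s w / s%:R + x / t + eps) * s%:R <= 0.
    by rewrite pmulr_lle0//; lra.
  have -> : (walk W s w / s%:R + x / t + eps) * s%:R =
    walk W s w + x * t + s%:R * eps by rewrite -tt; field; rewrite !gt_eqF.
  lra.
rewrite /log_martingale sqrrN.
have : b * (a + s%:R * (b / 2)) <= b * (- walk W s w) by rewrite ler_wpM2l.
lra.
Qed.

(** At a time s <= T the index condition puts the walk beyond the chord of
    the block of s, or, if that block ends after T / exp 1, beyond the line
    s eps at a time of order T.  The crossing probabilities are summed over the blocks. *)
Lemma index_below_prob : expR 1 ^+ 2 <= T%:R * eps ^+ 2 ->
  (P [set w | exists2 s, (1 <= s <= T)%N & index_below s w] <=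
   (30 * expR 1 * Num.sqrt (ln (eps ^+ 2 * T%:R)) / (eps ^+ 2 * T%:R)
    + 16 * expR 1 / (eps ^+ 2 * T%:R))%:E)%E.
Proof.
rewrite [X in _ <= X -> _]mulrC; set y := eps ^+ 2 * T%:R => ey.
have T0 : 0 < T%:R :> R by rewrite ltr0n.
have e20 : 0 < eps ^+ 2 by rewrite exprn_gt0.
have y0 : 0 < y by rewrite mulr_gt0.
pose L := ln y.
have L2 : 2 <= L.
  by rewrite /L -[leLHS](@expRK R) ler_ln ?posrE ?expR_gt0// -[2]mulr1 expRM_natl.
pose r : R := 1 + (Num.sqrt L)^-1.
have sL1 : 1 <= Num.sqrt L.
  by rewrite -[leLHS]sqrtr1 ler_wsqrtr//; lra.
have sL0 : 0 < Num.sqrt L by lra.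
have r1 : 1 < r by rewrite ltrDl invr_gt0.
have r2 : r <= 2 by rewrite /r -[leRHS]/(1 + 1) lerD2l invf_le1.
have r0 : 0 < r by lra.
have rk0 k : 0 < r ^+ k by rewrite exprn_gt0.
have e2 := expR1_ge2 R.
pose x k := Num.sqrt (2 * ln (T%:R / (r * r ^+ k) ^+ 2)).
pose a k := x k * r ^+ k * r / (1 + r).
pose b k := 2 * (x k / (r ^+ k * (1 + r)) + eps).
pose crossing l c := [set w | exists n, c <= log_martingale W l n w].
(* The blocks that end after T / exp 1 are left to tail. *)
pose block k := if (r * r ^+ k) ^+ 2 * expR 1 <= T%:R
                then crossing (- b k) (a k * b k) else set0.
pose tail := crossing (- eps) (y / (2 * expR 1 * r ^+ 2)).
have mcrossing l c : measurable (crossing l c).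
  exact: measurable_ville_event.
have mtail : measurable tail by exact: mcrossing.
have mblock k : measurable (block k) by rewrite /block; case: ifP.
have [K TK] := power_unbounded (Num.sqrt T%:R) r1.
have Pblock k : (P (block k) <=
    (27 * y^-1 * (eps * r ^+ k.+1 / (1 + eps * r ^+ k.+1) ^+ 2))%:E)%E.
  pose w := eps * r ^+ k.+1.
  have w0 : 0 < w by rewrite mulr_gt0.
  rewrite /block; case: ifPn => [vT|_]; last first.
    rewrite measure0 lee_fin -/w mulr_ge0//; first by rewrite mulr_ge0// invr_ge0 ltW.
    by rewrite divr_ge0 ?sqr_ge0// ltW.
  apply: le_trans (ville_gaussian _ hW _) _; rewrite lee_fin.
  have wE : w = eps * (r * r ^+ k) by rewrite /w exprS.
  have v0 : 0 < (r * r ^+ k) ^+ 2 by rewrite exprn_gt0// mulr_gt0.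
  have logE : L - 2 * ln w = ln (T%:R / (r * r ^+ k) ^+ 2).
    rewrite mulr_natl -lnXn// -ln_div ?posrE ?exprn_gt0//; congr ln.
    by rewrite /y wE; move: (rk0 k) => ?; field; rewrite !gt_eqF.
  have M1 : 1 <= L - 2 * ln w.
    rewrite logE -[leLHS](@expRK R) ler_ln ?posrE ?expR_gt0 ?divr_gt0//.
    by rewrite ler_pdivlMr// mulrC.
  have := block_exponent_bound L2 w0 M1; rewrite -/r expRN lnK//.
  apply: le_trans; rewrite ler_expR lerN2 logE -/(x k).
  have x2 : x k ^+ 2 = 2 * ln (T%:R / (r * r ^+ k) ^+ 2).
    by rewrite sqr_sqrtr// -logE; lra.
  have -> : ln (T%:R / (r * r ^+ k) ^+ 2) = x k ^+ 2 / 2 by rewrite x2; field.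
  rewrite le_eqVlt; apply/orP; left; apply/eqP.
  rewrite /a /b wE; field.
  by rewrite !gt_eqF//; lra.
have Ptail : (P tail <= (8 * expR 1 / y)%:E)%E.
  apply: le_trans (ville_gaussian _ hW _) _; rewrite lee_fin.
  have d0 : 0 < 2 * expR 1 * r ^+ 2 by rewrite !mulr_gt0 ?expR_gt0 ?exprn_gt0.
  set z := y / _; have z0 : 0 < z by rewrite divr_gt0.
  apply: (@le_trans _ _ z^-1).
    rewrite expRN lef_pV2 ?posrE ?expR_gt0//.
    by have := expR_ge1Dx z; lra.
  rewrite /z invf_div ler_pM2r ?invr_gt0//.
  have : r ^+ 2 <= 4 by nra.
  nra.
pose blocks := \big[setU/set0]_(k < K) block k.
have mblocks : measurable blocks by exact: bigsetU_measurable.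
apply: (@le_trans _ _ (P (tail `|` blocks))).
  apply: le_measure; rewrite ?inE.
  - rewrite (_ : [set w | _] = \bigcup_(s in [set s | (1 <= s <= T)%N])
        [set w | index_below s w]).
      by apply: bigcup_measurable => s _; exact: measurable_index_below.
    by apply/seteqP; split=> w [s]; exists s.
  - exact: measurableU.
  - move=> w [s /andP[s1 sT] below].
    have s0 : 0 < s%:R :> R by rewrite ltr0n.
    have sq1 : 1 <= Num.sqrt s%:R :> R.
      by rewrite -[leLHS]sqrtr1 ler_wsqrtr// ler1n.
    have sqK : Num.sqrt s%:R < r ^+ K.
      by apply: le_lt_trans TK; rewrite ler_wsqrtr// ler_nat.
    have [k kK sk] := block_index_exists r1 sq1 sqK.
    have [vT|vT] := leP ((r * r ^+ k) ^+ 2 * expR 1) T%:R.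
      right; rewrite /blocks -(bigcup_mkord _ block); exists k => //.
      rewrite /block vT; exists s.
      exact: index_below_block.
    left; exists s; move: below; rewrite /index_below emp_mean_walk => below.
    have sT' : T%:R <= s%:R * (expR 1 * r ^+ 2).
      apply: (le_trans (ltW vT)).
      have -> : (r * r ^+ k) ^+ 2 * expR 1 = (r ^+ k) ^+ 2 * (expR 1 * r ^+ 2).
        by rewrite exprMn mulrAC mulrC [r ^+ 2 * _]mulrC.
      rewrite ler_wpM2r ?mulr_ge0 ?expR_ge0 ?exprn_ge0 ?(ltW r0)//.
      rewrite -[leRHS](sqr_sqrtr (ltW s0)) ler_sqr ?nnegrE ?(ltW (rk0 k)) ?sqrtr_ge0//.
      by case/andP: sk.
    have drift : s%:R * eps <= - walk W s w.
      move: below; set bonus := Num.sqrt _ => below.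
      have bonus0 : 0 <= bonus by exact: sqrtr_ge0.
      have : (walk W s w / s%:R + eps) * s%:R <= 0 by rewrite pmulr_lle0//; lra.
      by rewrite mulrDl divfK ?gt_eqF//; lra.
    rewrite /log_martingale sqrrN ler_pdivrMr; last first.
      by rewrite !mulr_gt0 ?expR_gt0 ?exprn_gt0.
    have : eps * (s%:R * eps) <= eps * - walk W s w by rewrite ler_pM2l.
    have : eps ^+ 2 * T%:R <= eps ^+ 2 * (s%:R * (expR 1 * r ^+ 2)) by rewrite ler_pM2l.
    rewrite -/y; have : 0 < 2 * expR 1 * r ^+ 2 by rewrite !mulr_gt0 ?expR_gt0 ?exprn_gt0.
    move=> d0 yle h.
    apply: (@le_trans _ _ (s%:R * (eps ^+ 2 / 2) * (2 * expR 1 * r ^+ 2))).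
      by apply: le_trans yle _; rewrite le_eqVlt; apply/orP; left; apply/eqP; field.
    rewrite ler_pM2r//; lra.
apply: le_trans (measureU2 _ _ _) _ => //.
apply: (@le_trans _ _ ((8 * expR 1 / y)%:E +
    (27 * y^-1 * (Num.sqrt L + 1))%:E)%E).
  apply: leeD => //.
  apply: le_trans (Boole_inequality _ _) _ => //.
  apply: le_trans (lee_sum _ (fun k _ => Pblock (val k))) _.
  rewrite sumEFin lee_fin -mulr_sumr ler_wpM2l//.
    by rewrite mulr_ge0// invr_ge0 ltW.
  have -> : Num.sqrt L + 1 = r / (r - 1).
    by rewrite {2}/r addrAC subrr add0r invrK mulrDl mul1r mulVf ?gt_eqF.
  rewrite -(big_mkord xpredT
    (fun k => eps * r ^+ k.+1 / (1 + eps * r ^+ k.+1) ^+ 2)).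
  exact: geometric_peeling_sum.
rewrite -EFinD lee_fin -/L.
have -> : 8 * expR 1 / y + 27 * y^-1 * (Num.sqrt L + 1) =
  (8 * expR 1 + 27 * (Num.sqrt L + 1)) / y by ring.
rewrite -mulrDl ler_pM2r ?invr_gt0//.
nra.
Qed.

End peeling.

(** * The three estimates *)

Theorem lemma1 (R : realType) (d : measure_display) (Omega : measurableType d)
    (P : probability Omega R) (W : nat -> {RV P >-> R})
    (eps Delta : R) (T : nat)
    (heps : 0 < eps) (hDelta : 0 < Delta) (hT : (1 <= T)%N)
    (hW : iid_standard_gaussian W) :
  [/\ (\int[P]_w settling_time W eps w <= (1 + 9 / eps ^+ 2)%:E)%E,
      2 <= T%:R * Delta ^+ 2 ->
      (\sum_(1 <= n < T.+1)
          P [set w | (Delta <= emp_mean W n w +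
                        Num.sqrt (2 / n%:R * ln (T%:R / n%:R)))%R]
        <= (2 * ln (T%:R * Delta ^+ 2 / 2) / Delta ^+ 2
            + 2 * Num.sqrt (pi * ln (T%:R * Delta ^+ 2 / 2)) / Delta ^+ 2
            + 2 / Delta ^+ 2 + 1)%:E)%E
    & expR 1 ^+ 2 <= T%:R * eps ^+ 2 ->
      (P [set w | exists2 s : nat, (1 <= s <= T)%N &
                    (emp_mean W s w + Num.sqrt (2 / s%:R * ln (T%:R / s%:R))
                      + eps <= 0)%R]
        <= (30 * expR 1 * Num.sqrt (ln (eps ^+ 2 * T%:R)) / (eps ^+ 2 * T%:R)
            + 16 * expR 1 / (eps ^+ 2 * T%:R))%:E)%E].
Proof.
split.
- exact: expectation_settling_time.
- exact: sum_index_exceeds_prob.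
- exact: index_below_prob.
Qed.
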